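(* Let $G$ be a finite graph and let $G_{\text{R-core}}$ be the R-core of $G$. Then $G_{\text{R-core}}$ is isomorphic to an induced subgraph of $G$.
   Context: Graphs are finite and undirected, loops allowed. For a finite set $B$ and a relation $R\subseteq V_G\times B$ with full image (every $b\in B$ has some $v$ with $(v,b)\in R$), $G\ast R$ is the graph with vertex set $B$ and edge set $\{(a,b)\in B\times B: \exists (u,v)\in E_G,\ (u,a)\in R,\ (v,b)\in R\}$. All relations here are required to have full domain (every $v\in V_G$ is related to some $b\in B$). $G$ and $H$ are weakly relationally equivalent if there are relations $R\subseteq V_G\times V_H$ and $S\subseteq V_H\times V_G$ with $G\ast R=H$ and $H\ast S=G$; this is an equivalence relation. A graph is an R-core if it has the minimum number of vertices among all graphs in its weak relational equivalence class. An R-core of $G$ is an R-core weakly relationally equivalent to $G$; it is unique up to isomorphism and denoted $G_{\text{R-core}}$. *)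

(* Defs.v *)
From HB Require Import structures.
From mathcomp Require Import all_boot.

Set Implicit Arguments.
Unset Strict Implicit.
Unset Printing Implicit Defensive.

(* Finite undirected graphs with vertex set V, loops allowed: the edge set is
   a symmetric set of ordered pairs. Symmetry is boolean, so that two graphs
   on V are equal as soon as their edge sets are. *)
Record graph (V : finType) := Graph {
  edges :> {set V * V};
  _ : [forall u, forall v, ((u, v) \in edges) ==> ((v, u) \in edges)]
}.

HB.instance Definition _ (V : finType) := [isSub for @edges V].

Lemma edges_sym (V : finType) (G : graph V) (u v : V) :
  ((u, v) \in edges G) = ((v, u) \in edges G).
Proof.
case: G => E /= /forallP symE.
by apply/idP/idP => uv; [move/forallP: (symE u) => /(_ v)
                        |move/forallP: (symE v) => /(_ u)]; rewrite uv.
Qed.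

Definition full_domain (V B : finType) (R : {set V * B}) : Prop :=
  forall v : V, exists b : B, (v, b) \in R.

Definition full_image (V B : finType) (R : {set V * B}) : Prop :=
  forall b : B, exists v : V, (v, b) \in R.

Section Star.
Variables (V B : finType) (G : graph V) (R : {set V * B}).

Definition star_edges : {set B * B} :=
  [set ab : B * B | [exists u, exists v,
     [&& (u, v) \in edges G, (u, ab.1) \in R & (v, ab.2) \in R]]].

Lemma star_edges_sym :
  [forall a, forall b, ((a, b) \in star_edges) ==> ((b, a) \in star_edges)].
Proof.
apply/forallP => a; apply/forallP => b; apply/implyP; rewrite !inE /=.
move=> /existsP[u /existsP[v /and3P[uv ua vb]]].
by apply/existsP; exists v; apply/existsP; exists u; rewrite edges_sym uv ua vb.
Qed.

Definition star : graph B := Graph star_edges_sym.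
End Star.

Definition weakly_equivalent (V W : finType) (G : graph V) (H : graph W) :
    Prop :=
  exists (R : {set V * W}) (S : {set W * V}),
    [/\ full_domain R /\ full_image R, full_domain S /\ full_image S,
        star G R = H & star H S = G].

Definition is_rcore (W : finType) (H : graph W) : Prop :=
  forall (U : finType) (K : graph U), weakly_equivalent H K -> #|W| <= #|U|.

Definition is_rcore_of (W V : finType) (H : graph W) (G : graph V) : Prop :=
  is_rcore H /\ weakly_equivalent H G.

Section Induced.
Variables (V : finType) (G : graph V) (A : {set V}).

Definition induced_edges :
    {set {x : V | x \in A} * {x : V | x \in A}} :=
  [set xy | (val xy.1, val xy.2) \in edges G].

Lemma induced_edges_sym :
  [forall x, forall y,
     ((x, y) \in induced_edges) ==> ((y, x) \in induced_edges)].
Proof.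
apply/forallP => x; apply/forallP => y; apply/implyP.
by rewrite !inE /= edges_sym.
Qed.

Definition induced : graph {x : V | x \in A} := Graph induced_edges_sym.
End Induced.

Definition isomorphic (V W : finType) (G : graph V) (H : graph W) : Prop :=
  exists2 f : V -> W, bijective f &
    forall u v : V, ((u, v) \in edges G) = ((f u, f v) \in edges H).

(* Main.v *)
Require Import Defs.
From mathcomp Require Import all_boot.

Set Implicit Arguments.
Unset Strict Implicit.
Unset Printing Implicit Defensive.

(** Let [R] and [S] satisfy [H * R = G] and [G * S = H], and let [P] be the
    composite of [R] and [S], so that [H * P = H]. If some set [X] had fewer
    than [#|X|] images under [P], then [P] would factor through the disjoint
    union of [P X] and the complement of [X], and [H] would be weakly equivalent
    to a graph smaller than itself. So when [H] is an R-core, Hall's theorem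
    yields a permutation [s] inside [P]; choose [f w] with [w R (f w) S (s w)].
    Then [uv] in [H] implies [(f u)(f v)] in [G], which implies [(s u)(s v)] in
    [H], and counting edges shows that these implications are equivalences.
    Finally [f u = f v] makes [u] and [v] twins in [H], and an R-core has no
    distinct twins. *)

(* Rado's argument: in a minimal family satisfying Hall's condition all sets are
   singletons. *)
Lemma hall (T U : finType) (F : T -> {set U}) :
  (forall X : {set T}, #|X| <= #|\bigcup_(x in X) F x|) ->
  exists2 f : T -> U, injective f & forall x, f x \in F x.
Proof.
have [n] := ubnP (\sum_x #|F x|); elim: n F => // n IHn F /ltnSE leFn hallF.
have F_gt0 x : 0 < #|F x|.
  by have := hallF [set x]; rewrite cards1 big_set1.
have [/existsP[x /card_gt1P[y1 [y2 [Fy1 Fy2 y12]]]]|] :=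
  boolP [exists x, 1 < #|F x|]; last first.
  rewrite negb_exists => /forallP F_le1.
  have /fin_all_exists [f fF] x : exists y, F x = [set y].
    by apply/cards1P; rewrite eqn_leq F_gt0 leqNgt F_le1.
  exists f => [x y fxy|x]; last by rewrite fF set11.
  apply/eqP; apply: contraT => neq_xy; have := hallF [set x; y].
  by rewrite cards2 neq_xy bigcup_setU !big_set1 !fF fxy setUid cards1.
pose F' y z := if z == x then F x :\ y else F z.
(* Deleting [y] from [F x] either preserves Hall's condition, and induction applies, or creates a
   violating set. Sets without [x] are unaffected, so the violating set contains [x]; the witness
   [X] is that set with [x] removed. *)
have violation y : y \in F x ->
    (exists2 f : T -> U, injective f & forall z, f z \in F z) \/
    exists2 X : {set T}, x \notin X &
      #|(F x :\ y) :|: \bigcup_(z in X) F z| <= #|X|.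
  move=> Fy.
  have [/forallP hallF'|] :=
    boolP [forall X : {set T}, #|X| <= #|\bigcup_(z in X) F' y z|].
    left; have [|f injf fF'] := IHn (F' y) _ hallF'.
      apply: leq_trans leFn; rewrite (bigD1 x) //= [ltnRHS](bigD1 x) //= /F' eqxx.
      rewrite [#|F x|](cardsD1 y) Fy add1n addSn ltnS leq_add2l.
      by apply: leq_sum => z /negPf->.
    exists f => // z; have := fF' z; rewrite /F'.
    by case: eqP => // -> /setD1P[].
  rewrite negb_forall => /existsP[X]; rewrite -ltnNge => ltX; right.
  have F'E (Y : {set T}) : x \notin Y ->
      \bigcup_(z in Y) F' y z = \bigcup_(z in Y) F z.
    move=> xY; apply: eq_bigr => z zY; rewrite /F'.
    by case: eqP zY xY => // -> ->.
  have xX : x \in X.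
    by apply: contraLR ltX => xX; rewrite F'E // -leqNgt.
  exists (X :\ x); first by rewrite setD11.
  move: ltX; rewrite (big_setD1 x) //= F'E ?setD11 // {1}/F' eqxx.
  by rewrite [#|X|](cardsD1 x) xX ltnS.
have [//|[X1 xX1 leX1]] := violation y1 Fy1.
have [//|[X2 xX2 leX2]] := violation y2 Fy2.
set A1 := _ :|: _ in leX1; set A2 := _ :|: _ in leX2.
(* All of [F x] is covered: [A1] omits at most [y1], which [A2] contains because [y1 != y2]. *)
have subU : \bigcup_(z in x |: (X1 :|: X2)) F z \subset A1 :|: A2.
  rewrite !bigcup_setU big_set1; apply/subsetP => y; rewrite !inE.
  have [->|_] := eqVneq y y1; first by rewrite y12 Fy1 /= !orbT.
  by move=> /or3P[] ->; rewrite ?orbT.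
have subI : \bigcup_(z in X1 :&: X2) F z \subset A1 :&: A2.
  apply/bigcupsP => z /setIP[zX1 zX2]; apply/subsetP => y yz.
  by rewrite !inE; apply/andP; split; apply/orP; right; apply/bigcupP; exists z.
(* Submodularity: the two bounds add up to [#|X1| + #|X2| + 1 <= #|A1| + #|A2|], while the
   violations give [#|A1| + #|A2| <= #|X1| + #|X2|]. *)
have := leq_add (leq_trans (hallF _) (subset_leq_card subU))
                (leq_trans (hallF _) (subset_leq_card subI)).
rewrite cardsU1 inE negb_or xX1 xX2 add1n addSn !cardsUI => ltX.
by have := leq_trans ltX (leq_add leX1 leX2); rewrite ltnn.
Qed.

Lemma graph_eq (V : finType) (G H : graph V) :
  (forall u v, ((u, v) \in edges G) = ((u, v) \in edges H)) -> G = H.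
Proof. by move=> eqGH; apply/val_inj/setP => -[u v]; apply: eqGH. Qed.

Lemma starP (V B : finType) (G : graph V) (R : {set V * B}) (a b : B) :
  reflect (exists u v, [/\ (u, v) \in edges G, (u, a) \in R & (v, b) \in R])
          ((a, b) \in edges (star G R)).
Proof.
rewrite inE /=; apply: (iffP existsP) => [[u /existsP[v /and3P[]]]|[u [v []]]].
  by exists u, v.
by move=> uv ua vb; exists u; apply/existsP; exists v; rewrite uv ua vb.
Qed.

Definition rel_comp (A B C : finType) (R : {set A * B}) (S : {set B * C}) :
    {set A * C} :=
  [set ac | [exists b, ((ac.1, b) \in R) && ((b, ac.2) \in S)]].

Lemma rel_compP (A B C : finType) (R : {set A * B}) (S : {set B * C})
    (a : A) (c : C) :
  reflect (exists2 b, (a, b) \in R & (b, c) \in S) ((a, c) \in rel_comp R S).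
Proof.
rewrite inE /=; apply: (iffP existsP) => [[b /andP[]]|[b ab bc]]; exists b => //.
by rewrite ab.
Qed.

Lemma star_comp (A B C : finType) (G : graph A) (R : {set A * B})
    (S : {set B * C}) :
  star (star G R) S = star G (rel_comp R S).
Proof.
apply: graph_eq => c d; apply/starP/starP.
  move=> [u [v [/starP[x [y [xy xu yv]]] uc vd]]].
  by exists x, y; split=> //; apply/rel_compP; [exists u | exists v].
move=> [x [y [xy /rel_compP[u xu uc] /rel_compP[v yv vd]]]].
by exists u, v; split=> //; apply/starP; exists x, y.
Qed.

Section RCore.
Variables (W : finType) (H : graph W).
Hypothesis coreH : is_rcore H.

(** [Q2] carries [star H Q1] back to [H], so this graph on [K] is weakly equivalent to [H], and
    minimality applies. *)
Lemma rcore_factor (K : finType) (Q1 : {set W * K}) (Q2 : {set K * W}) :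
  full_domain Q1 -> full_image Q1 -> full_domain Q2 -> full_image Q2 ->
  star H (rel_comp Q1 Q2) = H -> #|W| <= #|K|.
Proof.
move=> dom1 im1 dom2 im2 fixH; apply: (@coreH K (star H Q1)).
by exists Q1, Q2; split; rewrite ?star_comp.
Qed.

Lemma rcore_hall (P : {set W * W}) (X : {set W}) :
  full_domain P -> full_image P -> star H P = H ->
  #|X| <= #|\bigcup_(x in X) [set y | (x, y) \in P]|.
Proof.
move=> domP imP fixH; set Y := \bigcup_(x in X) _.
have YP x y : x \in X -> (x, y) \in P -> y \in Y.
  by move=> xX xy; apply/bigcupP; exists x; rewrite ?inE.
pose K : finType := ({y | y \in Y} + {x | x \in ~: X})%type.
(* Vertices of [X] take their step of [P] on entering [K], the others on leaving it, so every path
   through [K] uses [P] exactly once. *)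
pose Q1 : {set W * K} := [set wk | match wk.2 with
  | inl y => (wk.1 \in X) && ((wk.1, val y) \in P)
  | inr x => wk.1 == val x end].
pose Q2 : {set K * W} := [set kw | match kw.1 with
  | inl y => kw.2 == val y
  | inr x => (val x, kw.2) \in P end].
have inXC x : x \notin X -> x \in ~: X by rewrite inE.
have Q12 : rel_comp Q1 Q2 = P.
  apply/setP => -[a b]; apply/rel_compP/idP => [[[y|x]]|ab]; rewrite ?inE /=.
  - by move=> /andP[_ ay] /eqP->.
  - by move=> /eqP->.
  have [aX|/inXC aX] := boolP (a \in X); last first.
    by exists (inr (exist _ a aX)); rewrite inE /=.
  by exists (inl (exist _ b (YP _ _ aX ab))); rewrite inE /= ?aX.
have : #|W| <= #|K|.
  apply: (@rcore_factor K Q1 Q2); last by rewrite Q12.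
  - move=> x; have [y] := domP x; rewrite -Q12 => /rel_compP[k xk _].
    by exists k.
  - case=> [[y yY]|[x xX]]; last by exists x; rewrite inE /=.
    by have /bigcupP[x xX] := yY; rewrite inE => xy; exists x; rewrite inE /= xX.
  - case=> [[y yY]|[x xX]]; first by exists y; rewrite inE /=.
    by have [y xy] := domP x; exists y; rewrite inE.
  - move=> y; have [x] := imP y; rewrite -Q12 => /rel_compP[k _ ky].
    by exists k.
by rewrite card_sum !card_sig -(cardsC X) leq_add2r.
Qed.

(** Otherwise [v] could be merged into [u], giving a weakly equivalent graph with one vertex
    fewer. *)
Lemma rcore_twin_free (u v : W) :
  (forall w, ((u, w) \in edges H) = ((v, w) \in edges H)) -> u = v.
Proof.
move=> twin; apply/eqP; apply: contraT => neq_uv.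
pose r w := if w == v then u else w.
have rV w : r w \in predC1 v by rewrite inE /r; case: ifP => // ->.
pose K : finType := {w | w \in predC1 v}.
have rK (k : K) : val k = r (val k).
  by case: k => k kv; rewrite /r /=; case: eqP kv => // ->; rewrite inE eqxx.
have twin_r w x : ((r w, x) \in edges H) = ((w, x) \in edges H).
  by rewrite /r; case: eqP => // ->.
(* The composite relates vertices with the same image under [r]; since [r] only replaces a vertex by
   its twin, no edge is added. *)
pose Q1 : {set W * K} := [set wk | val wk.2 == r wk.1].
pose Q2 : {set K * W} := [set kw | val kw.1 == r kw.2].
have Q12 a b : ((a, b) \in rel_comp Q1 Q2) = (r a == r b).
  apply/rel_compP/eqP => [[k]|rab].
    by rewrite !inE /= => /eqP<- /eqP<-.
  by exists (exist _ (r a) (rV a)); rewrite inE /= ?rab.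
have : #|W| <= #|K|.
  apply: (@rcore_factor K Q1 Q2).
  - by move=> w; exists (exist _ (r w) (rV w)); rewrite inE /=.
  - by move=> k; exists (val k); rewrite inE /= -rK.
  - by move=> k; exists (val k); rewrite inE /= -rK.
  - by move=> w; exists (exist _ (r w) (rV w)); rewrite inE /=.
  apply: graph_eq => a b; apply/starP/idP => [[x [y []]]|ab]; last first.
    by exists a, b; rewrite !Q12 !eqxx.
  rewrite !Q12 => xy /eqP rxa /eqP ryb.
  rewrite -twin_r -rxa twin_r edges_sym -twin_r -ryb twin_r.
  by rewrite edges_sym.
by rewrite card_sig cardC1 -ltnS prednK ?ltnn //; apply/card_gt0P; exists v.
Qed.

End RCore.

Theorem theorem4p2p11 (V : finType) (G : graph V) (W : finType) (H : graph W)
  (HG : is_rcore_of H G) :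
  exists A : {set V}, isomorphic H (induced G A).
Proof.
case: HG => coreH [R [S [[domR imR] [domS imS] starR starS]]].
pose P := rel_comp R S.
have fixP : star H P = H by rewrite -star_comp starR starS.
have domP : full_domain P.
  move=> w; have [x wx] := domR w; have [y xy] := domS x.
  by exists y; apply/rel_compP; exists x.
have imP : full_image P.
  move=> w; have [x xw] := imS w; have [y yx] := imR x.
  by exists y; apply/rel_compP; exists x.
have [s inj_s sP] :=
  hall (fun X => rcore_hall coreH X domP imP fixP).
have /fin_all_exists [f fP] w : exists x, ((w, x) \in R) /\ ((x, s w) \in S).
  by have := sP w; rewrite inE => /rel_compP[x]; exists x.
have HtoG u v : (u, v) \in edges H -> (f u, f v) \in edges G.
  move=> uv; rewrite -starR; apply/starP; exists u, v.
  by split=> //; [case: (fP u) | case: (fP v)].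
have GtoH u v : (f u, f v) \in edges G -> (s u, s v) \in edges H.
  move=> uv; rewrite -starS; apply/starP; exists (f u), (f v).
  by split=> //; [case: (fP u) | case: (fP v)].
pose s2 (uv : W * W) := (s uv.1, s uv.2).
have inj_s2 : injective s2 by move=> [a b] [c d] [/inj_s-> /inj_s->].
(* One inclusion comes from [HtoG] and [GtoH]; as [s2] is injective, the preimage has at most as
   many elements as [edges H], which forces equality. *)
have fixE : edges H = s2 @^-1: edges H.
  apply/eqP; rewrite eqEcard; apply/andP; split.
    by apply/subsetP => -[u v] /HtoG/GtoH; rewrite inE.
  rewrite -(card_imset _ inj_s2); apply/subset_leq_card/subsetP => _ /imsetP[x + ->].
  by rewrite inE.
have HE u v : ((u, v) \in edges H) = ((f u, f v) \in edges G).
  by apply/idP/idP => [/HtoG //|/GtoH]; rewrite [in X in _ -> X]fixE inE.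
have inj_f : injective f.
  by move=> u v fuv; apply: (rcore_twin_free coreH) => w; rewrite !HE fuv.
have fA w : f w \in f @: [set: W] by rewrite imset_f.
exists (f @: [set: W]), (fun w => exist _ (f w) (fA w)).
  apply: inj_card_bij => [u v [/inj_f //]|].
  by rewrite card_sig card_imset ?cardsT.
by move=> u v; rewrite HE [RHS]inE.
Qed.
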